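(* There exists a real number $[x]\in\mathcal{S}_{\mathbb{R}}$ such that for all real numbers $[a]\in\mathcal{S}_{\mathbb{R}}$ we have $[x]*[a]=[a]$.
   Context: Conventions. $\omega=\{0,1,2,\dots\}$, $\omega_+=\omega\setminus\{0\}$, $[a,b]_\omega=\{n\in\omega:a\le n\le b\}$, $[a,\infty]_\omega=\{n\in\omega:n\ge a\}$; empty products equal $1$. A system function $\vartheta:\omega_+\to[2,\infty]_\omega$ is fixed. Contractions. For $f:\omega\to\omega$ and $n\in\omega_+$, the contraction $c_n$ is applicable to $f$ iff $f(n+1)\ge\vartheta(n)$, and then $c_n(f)(n)=f(n)+1$, $c_n(f)(n+1)=f(n+1)-\vartheta(n)$, $c_n(f)(k)=f(k)$ for other $k$. A sequence of contractions is a finite (possibly empty) composition of contractions; it is applicable to $f$ iff each contraction in turn is applicable to the result of the preceding ones. Sign. For $f:\omega\to\omega$, $\sigma(f)=0$ if $f(0)$ is odd and $\sigma(f)=1$ if $f(0)$ is even. Auxiliary functions. $h:\omega\to\omega$ is a primary auxiliary function ($h\in A_p$) if $h(k)<\vartheta(k-1)$ for all $k\ge2$ and for every $N\in\omega_+$ there is $M\ge N+1$ with $h(M)\ne\vartheta(M-1)-1$. It is a secondary auxiliary function ($h\in A_s$) if $h(k)<\vartheta(k-1)$ for all $k\ge2$ and there is $N\in\omega_+$ with $h(M)=\vartheta(M-1)-1$ for all $M\ge N+1$; the least such $N$ is $N^h_{\min}$. Base set. $W_1$ is the set of pairs $(h_p,h_s)\in A_p\times A_s$ such that, with $N=N^{h_s}_{\min}$,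 $h_p(k)=h_s(k)$ for $k<N$, $h_p(N)=h_s(N)+1$, and $h_p(k)=0$ for $k>N$. Two pairs in $W_1$ are equivalent if their first components agree on $\omega_+$ and have the same sign; $F$ is the collection of sets obtained by taking, for each equivalence class, the set of all functions that are components of its pairs. $W_2$ is the set of primary auxiliary functions occurring in no pair of $W_1$; two elements of $W_2$ are equivalent if they agree on $\omega_+$ and have the same sign; $G_2$ is the set of equivalence classes. The base set is $B=F\cup G_2$. Real numbers. For $b\in B$, $r_b$ is the set of $f:\omega\to\omega$ for which there is $h\in b$ such that for every $N\in\omega_+$ some sequence of contractions $\mathcal{C}$ applicable to $f$ satisfies $\mathcal{C}(f)(n)=h(n)$ for all $n\in[0,N]_\omega$. Let $b_1,b_2\in B$ be the elements containing respectively the zero function, and the function with value $1$ at $0$ and $0$ elsewhere. $\mathcal{S}_{\mathbb{R}}$ (the set of real numbers) consists of all $r_b$ with $b\in B\setminus\{b_1,b_2\}$ together with $[0]:=r_{b_1}\cup r_{b_2}$. Distinct real numbers are disjoint. A function lying in some real number is called finite, and $[f]$ denotes the real number containing $f$. Multiplication. For $a,b\in\omega$ let $\Upsilon(a,b)=\max\{a,b\}-\min\{a,b\}$. For $n,k,K\in\omega_+$ let $$R(n,k,K)=\max\Big\{t\in\omega:\ t\prod_{j=1}^{n-1}\vartheta(j)\prod_{j=1}^{k-1}\vartheta(j)\le\prod_{j=1}^{K-1}\vartheta(j)\Big\}.$$ The rest function is $r(n,k,1)=R(n,k,1)$ and $r(n,k,M)=\Upsilon\big(R(n,k,M),\ \vartheta(M-1)R(n,k,M-1)\big)$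 for $M\ge2$. For finite $f,g$ the sub-product $f*g:\omega\to\omega$ is $(f*g)(0)=f(0)+g(0)$ and $(f*g)(M)=\sum_{n=1}^M\sum_{k=1}^M f(n)g(k)\,r(n,k,M)$ for $M\in\omega_+$. Multiplication of real numbers: $[f]*[g]:=[f*g]$ for any $f\in[f]$, $g\in[g]$ (independent of the choice of representatives). *)

(* Defs.v *)
From mathcomp Require Import all_boot.
From mathcomp Require Import boolp classical_sets.

Set Implicit Arguments.
Unset Strict Implicit.
Unset Printing Implicit Defensive.

Local Open Scope classical_set_scope.
Local Open Scope nat_scope.

(* A system function lives on the positive integers; the value [theta 0] is
   never used. *)
Definition system_function (theta : nat -> nat) : Prop :=
  forall n, 0 < n -> 2 <= theta n.

Definition applicable (theta : nat -> nat) (n : nat) (f : nat -> nat) : Prop :=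
  0 < n /\ theta n <= f n.+1.

Definition contract (theta : nat -> nat) (n : nat) (f : nat -> nat) :
    nat -> nat :=
  fun k => if k == n then f n + 1
           else if k == n.+1 then f n.+1 - theta n
           else f k.

(* A sequence of contractions is the list of its indices, the head being
   performed first. *)
Fixpoint applicable_seq (theta : nat -> nat) (c : seq nat) (f : nat -> nat) :
    Prop :=
  if c is n :: c' then
    applicable theta n f /\ applicable_seq theta c' (contract theta n f)
  else True.

Fixpoint contract_seq (theta : nat -> nat) (c : seq nat) (f : nat -> nat) :
    nat -> nat :=
  if c is n :: c' then contract_seq theta c' (contract theta n f) else f.

Definition sign (f : nat -> nat) : nat := if odd (f 0) then 0 else 1.

Definition primary (theta : nat -> nat) : set (nat -> nat) :=
  [set h | (forall k, 2 <= k -> h k < theta (k - 1)) /\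
           (forall N, 0 < N ->
              exists2 M, N + 1 <= M & h M <> theta (M - 1) - 1)].

Definition maximal_after (theta h : nat -> nat) (N : nat) : Prop :=
  0 < N /\ forall M, N + 1 <= M -> h M = theta (M - 1) - 1.

Definition secondary (theta : nat -> nat) : set (nat -> nat) :=
  [set h | (forall k, 2 <= k -> h k < theta (k - 1)) /\
           (exists N, maximal_after theta h N)].

Definition is_Nmin (theta h : nat -> nat) (N : nat) : Prop :=
  maximal_after theta h N /\
  forall N', maximal_after theta h N' -> N <= N'.

Definition W1 (theta : nat -> nat) : set ((nat -> nat) * (nat -> nat)) :=
  [set p | [/\ primary theta p.1, secondary theta p.2 &
     exists N, [/\ is_Nmin theta p.2 N,
                   (forall k, k < N -> p.1 k = p.2 k),
                   p.1 N = p.2 N + 1 &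
                   forall k, N < k -> p.1 k = 0]]].

Definition equiv_fun (f g : nat -> nat) : Prop :=
  (forall n, 0 < n -> f n = g n) /\ sign f = sign g.

Definition baseF (theta : nat -> nat) : set (set (nat -> nat)) :=
  [set b | exists2 p, W1 theta p &
     b = [set h | exists q, [/\ W1 theta q, equiv_fun p.1 q.1 &
                                h = q.1 \/ h = q.2]]].

Definition W2 (theta : nat -> nat) : set (nat -> nat) :=
  [set h | primary theta h /\
           forall q, W1 theta q -> h <> q.1 /\ h <> q.2].

Definition baseG2 (theta : nat -> nat) : set (set (nat -> nat)) :=
  [set b | exists2 h, W2 theta h &
     b = [set h' | W2 theta h' /\ equiv_fun h h']].

Definition base (theta : nat -> nat) : set (set (nat -> nat)) :=
  baseF theta `|` baseG2 theta.

(* The member of a collection [P] of pairwise disjoint sets that contains [x]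
   (the empty set if there is none). *)
Definition block (T : Type) (P : set (set T)) (x : T) : set T :=
  [set y | exists X, [/\ P X, X x & X y]].

Definition real_of_base (theta : nat -> nat) (b : set (nat -> nat)) :
    set (nat -> nat) :=
  [set f | exists2 h, b h & forall N, 0 < N ->
     exists2 c, applicable_seq theta c f &
                forall n, n <= N -> contract_seq theta c f n = h n].

Definition base_zero_even (theta : nat -> nat) : set (nat -> nat) :=
  block (base theta) (fun=> 0).

Definition base_zero_odd (theta : nat -> nat) : set (nat -> nat) :=
  block (base theta) (fun n => if n == 0 then 1 else 0).

Definition real_zero (theta : nat -> nat) : set (nat -> nat) :=
  real_of_base theta (base_zero_even theta) `|`
  real_of_base theta (base_zero_odd theta).

Definition reals (theta : nat -> nat) : set (set (nat -> nat)) :=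
  [set X | (exists b, [/\ base theta b, b <> base_zero_even theta,
                          b <> base_zero_odd theta &
                          X = real_of_base theta b]) \/
           X = real_zero theta].

Definition real_class (theta : nat -> nat) (f : nat -> nat) :
    set (nat -> nat) :=
  block (reals theta) f.

Definition upsilon (a b : nat) : nat := maxn a b - minn a b.

Definition prod_below (theta : nat -> nat) (n : nat) : nat :=
  \prod_(1 <= j < n) theta j.

(* For a system function the products are positive, so every [t] in the set
   defining [R(n,k,K)] is at most [prod_below theta K]; bounding [t] by it
   therefore does not change the maximum. *)
Definition Rmax (theta : nat -> nat) (n k K : nat) : nat :=
  \max_(t < (prod_below theta K).+1
        | t * prod_below theta n * prod_below theta k <= prod_below theta K) t.

Definition rest (theta : nat -> nat) (n k M : nat) : nat :=
  if M == 1 then Rmax theta n k 1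
  else upsilon (Rmax theta n k M) (theta (M - 1) * Rmax theta n k (M - 1)).

Definition subproduct (theta f g : nat -> nat) : nat -> nat :=
  fun M => if M == 0 then f 0 + g 0
           else \sum_(1 <= n < M.+1) \sum_(1 <= k < M.+1)
                  f n * g k * rest theta n k M.

(* [f] * [g] is [f * g] for whatever representatives f and g.  The set below
   is the intersection of the classes [f * g] over all representatives f of X
   and g of Y: when these classes coincide it is their common value, and for
   real numbers X, Y, Z (nonempty, pairwise equal or disjoint) the equation
   [real_mul theta X Y = Z] means that [f * g] is Z for every choice of f
   and g. *)
Definition real_mul (theta : nat -> nat) (X Y : set (nat -> nat)) :
    set (nat -> nat) :=
  [set h | forall f g, X f -> Y g -> real_class theta (subproduct theta f g) h].

(* Main.v *)
(* The value of f is sum_(n >= 1) f(n) / P(n), with P(n) = prod_(j < n) theta(j).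
   A contraction at n leaves it unchanged and only shifts mass from n+1 to n,
   and a base element consists of the theta-adic expansions (both of them, when
   there are two) of one value with one sign; so r_b is the set of all f with
   the value and the parity of b.  The terms r(n,k,M) are the theta-adic digits
   of 1 / (P(n)P(k)), hence the value of f * g is the product of the values, and
   the class of (0; 1, 0, 0, ...), of value 1 and even sign, is neutral. *)
Require Import Defs.
From mathcomp Require Import all_boot.
From mathcomp Require Import boolp classical_sets.
From mathcomp Require Import all_order all_algebra.
From mathcomp Require Import zify ring lra.

Set Implicit Arguments.
Unset Strict Implicit.
Unset Printing Implicit Defensive.

Import Order.TTheory GRing.Theory Num.Theory.

Section Expansions.

Variable theta : nat -> nat.
Hypothesis theta_system : system_function theta.

Local Open Scope classical_set_scope.
Local Open Scope ring_scope.

(** * Products of the system function and the weights of positions *)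

Local Notation P := (prod_below theta).

Lemma theta_ge2 n : (0 < n)%N -> (2 <= theta n)%N.
Proof. exact: theta_system. Qed.

Lemma prod_below0 : P 0 = 1%N.
Proof. by rewrite /prod_below big_geq. Qed.

Lemma prod_below1 : P 1 = 1%N.
Proof. by rewrite /prod_below big_geq. Qed.

Lemma prod_belowS n : (0 < n)%N -> P n.+1 = (P n * theta n)%N.
Proof. by move=> n0; rewrite /prod_below big_nat_recr. Qed.

Lemma prod_below_gt0 n : (0 < P n)%N.
Proof.
elim: n => [|[|n] IHn]; rewrite ?prod_below0 ?prod_below1 //.
by rewrite prod_belowS // muln_gt0 IHn (leq_trans _ (theta_ge2 _)).
Qed.

Lemma leq_prod_below n : (n <= P n)%N.
Proof.
elim: n => [|[|n] IHn] //; first by rewrite prod_below1.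
rewrite prod_belowS //; have := @theta_ge2 n.+1 isT; nia.
Qed.

Lemma dvdn_prod_below n m : (n <= m)%N -> (P n %| P m)%N.
Proof.
elim: m => [|m IHm]; first by rewrite leqn0 => /eqP ->.
rewrite leq_eqVlt => /orP[/eqP -> //|]; rewrite ltnS => /IHm /dvdn_trans; apply.
by case: m {IHm} => [|m]; rewrite ?prod_below0 // (@prod_belowS m.+1) // dvdn_mulr.
Qed.

Definition weight n : rat := (P n)%:R^-1.

Lemma weight1 : weight 1 = 1.
Proof. by rewrite /weight prod_below1 invr1. Qed.

Lemma weight_gt0 n : 0 < weight n.
Proof. by rewrite invr_gt0 ltr0n prod_below_gt0. Qed.

Lemma prod_below_neq0 n : (P n)%:R != 0 :> rat.
Proof. by rewrite pnatr_eq0 -lt0n prod_below_gt0. Qed.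

Lemma weightS n : (0 < n)%N -> (theta n)%:R * weight n.+1 = weight n.
Proof.
move=> n0; rewrite /weight prod_belowS // natrM; field.
rewrite prod_below_neq0 /= pnatr_eq0; have := theta_ge2 n0; lia.
Qed.

Lemma weight_small (e : rat) : 0 < e -> exists L, forall M, (L <= M)%N -> weight M < e.
Proof.
move=> e0; have e1 : 0 < e^-1 by rewrite invr_gt0.
exists (Num.bound e^-1) => M LM; rewrite /weight -[e]invrK ltf_pV2 ?posrE ?ltr0n ?prod_below_gt0 //.
apply: lt_le_trans (archi_boundP (ltW e1)) _.
by rewrite ler_nat (leq_trans LM) ?leq_prod_below.
Qed.

(** * Partial sums and values *)

Definition psum (f : nat -> nat) L : rat :=
  \sum_(1 <= n < L.+1) (f n)%:R * weight n.

Lemma psum0 f : psum f 0 = 0.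
Proof. by rewrite /psum big_geq. Qed.

Lemma psumS f L : psum f L.+1 = psum f L + (f L.+1)%:R * weight L.+1.
Proof. by rewrite /psum big_nat_recr. Qed.

Lemma eq_psum f g L : (forall n, (0 < n <= L)%N -> f n = g n) ->
  psum f L = psum g L.
Proof. by move=> fg; apply: eq_big_nat => n n1; rewrite fg. Qed.

Lemma psum_le f L M : (L <= M)%N -> psum f L <= psum f M.
Proof.
elim: M => [|M IHM]; first by rewrite leqn0 => /eqP ->.
rewrite leq_eqVlt => /orP[/eqP -> //|]; rewrite ltnS => /IHM /le_trans; apply.
by rewrite psumS lerDl mulr_ge0 // ltW // weight_gt0.
Qed.

Lemma psum_ge0 f L : 0 <= psum f L.
Proof. by rewrite -(psum0 f) psum_le. Qed.

(* The left Dedekind cut of the possibly infinite value sum_n f(n) / P(n). *)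
Definition below f (q : rat) : Prop := exists L, q < psum f L.

(** Comparing cuts in [rat] treats infinite and irrational sums alike, and no limit has to be
    formed. *)
Definition same_value f g := forall q, below f q <-> below g q.

Lemma eq_same_value f g : (forall n, (0 < n)%N -> f n = g n) -> same_value f g.
Proof.
move=> fg q; rewrite /below.
by split=> -[L qL]; exists L; rewrite (@eq_psum f g L) // in qL *;
   move=> n /andP[n0 _]; exact: fg.
Qed.

Lemma same_value_sym f g : same_value f g -> same_value g f.
Proof. by move=> fg q; rewrite fg. Qed.

Lemma same_value_trans f g h : same_value f g -> same_value g h -> same_value f h.
Proof. by move=> fg gh q; rewrite fg. Qed.

(** A partial sum of [f] above [u] would put [u] into the cut of [f], hence into that of [g]. *)
Lemma same_value_bound f g (u : rat) : same_value f g ->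
  (forall L, psum g L <= u) -> forall L, psum f L <= u.
Proof.
move=> fg gu L; rewrite leNgt; apply/negP => uL.
have /fg[M] : below f u by exists L.
by rewrite ltNge gu.
Qed.

Definition null f := forall n, (0 < n)%N -> f n = 0%N.

(** Vanishing becomes a property of the cut, so that [same_value] transports it. *)
Lemma nullP f : null f <-> ~ below f 0.
Proof.
split=> [f0 [L]|nf [//|n] _].
  by rewrite (@eq_psum f (fun=> 0%N)) => [|n /andP[/f0]//];
     rewrite /psum big1 ?ltxx // => n _; rewrite mul0r.
apply: contrapT => fn0; apply: nf; exists n.+1; rewrite psumS.
rewrite ltr_wpDl ?psum_ge0 // mulr_gt0 ?weight_gt0 // ltr0n lt0n.
exact/eqP.
Qed.

Lemma same_value_null f g : same_value f g -> null f -> null g.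
Proof. by move=> fg /nullP nf; apply/nullP => /fg. Qed.

(** * Effect of contractions on partial sums *)

Lemma contract_gt n f k : (n.+1 < k)%N -> contract theta n f k = f k.
Proof. by move=> nk; rewrite /contract !ifN //; apply/eqP; lia. Qed.

Lemma contract_psum_lt n f k : (k < n)%N -> psum (contract theta n f) k = psum f k.
Proof.
move=> kn; apply: eq_psum => m /andP[m0 mk]; rewrite /contract.
by rewrite !ifN //; apply/eqP; lia.
Qed.

Lemma contract_psum_eq n f : (0 < n)%N ->
  psum (contract theta n f) n = psum f n + weight n.
Proof.
case: n => // n _; rewrite !psumS contract_psum_lt //.
by rewrite /contract eqxx addn1 -natr1; ring.
Qed.

Lemma contract_psum_gt n f k : applicable theta n f -> (n < k)%N ->
  psum (contract theta n f) k = psum f k.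
Proof.
move=> [n0 tf]; elim: k => // k IHk; rewrite ltnS leq_eqVlt => /orP[/eqP <-|nk].
  rewrite !psumS contract_psum_eq // /contract eqxx ifN; last by apply/eqP; lia.
  by rewrite natrB // -(weightS n0); ring.
by rewrite !psumS IHk // contract_gt.
Qed.

(** Only the partial sum of length [n] changes. It grows by [weight n], which the term of [f] at
    [n.+1] covers because [theta n <= f n.+1]. *)
Lemma contract_psum n f L : applicable theta n f ->
  psum f L <= psum (contract theta n f) L <= psum f L.+1.
Proof.
move=> nf; have [n0 tf] := nf.
case: (ltngtP L n) => [/contract_psum_lt ->|/(contract_psum_gt nf) ->|->];
  rewrite ?lexx ?psum_le //=.
rewrite contract_psum_eq // lerDl ltW ?weight_gt0 //= psumS lerD2l -(weightS n0).
by rewrite ler_wpM2r ?ler_nat // ltW ?weight_gt0.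
Qed.

Lemma contract_seq_psum c f L : applicable_seq theta c f ->
  psum f L <= psum (contract_seq theta c f) L <= psum f (L + size c).
Proof.
elim: c f L => [|n c IHc] f L /=; first by rewrite addn0 lexx.
move=> [/contract_psum an /(IHc _ L)/andP[a1 a2]].
have /andP[b1 _] := an L; have /andP[_ b2] := an (L + size c)%N.
by rewrite (le_trans b1 a1) (le_trans a2) // addnS.
Qed.

Lemma contract_seq0 c f : applicable_seq theta c f ->
  contract_seq theta c f 0%N = f 0%N.
Proof.
elim: c f => //= n c IHc f [[n0 _] /IHc ->].
by rewrite /contract !ifN //; apply/eqP; lia.
Qed.

Lemma contract_seq_cat c d f :
  contract_seq theta (c ++ d) f = contract_seq theta d (contract_seq theta c f).
Proof. by elim: c f => /=. Qed.

Lemma applicable_seq_cat c d f :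
  applicable_seq theta c f -> applicable_seq theta d (contract_seq theta c f) ->
  applicable_seq theta (c ++ d) f.
Proof. by elim: c f => //= n c IHc f [an ac] ad; split=> //; apply: IHc. Qed.

Definition reaches f h := forall N, (0 < N)%N ->
  exists2 c, applicable_seq theta c f &
             forall n, (n <= N)%N -> contract_seq theta c f n = h n.

(** Partial sums of [h] are partial sums of contracted forms of [f], and these are squeezed between
    a shorter and a longer partial sum of [f]. *)
Lemma reaches_same_value f h : reaches f h -> same_value f h /\ f 0%N = h 0%N.
Proof.
move=> fh; split; last first.
  by have [c /contract_seq0 <- ->] := fh 1%N isT.
move=> q; split=> -[L qL].
  exists L.+1; apply: lt_le_trans qL _.
  have [c ac ch] := fh L.+1 isT.
  rewrite -(@eq_psum (contract_seq theta c f) h) => [|n /andP[_]]; last exact: ch.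
  have /andP[h1 _] := contract_seq_psum L.+1 ac.
  by rewrite (le_trans _ h1) ?psum_le.
have [c ac ch] := fh L.+1 isT.
have /andP[_ h2] := contract_seq_psum L.+1 ac.
exists (L.+1 + size c)%N; apply: lt_le_trans h2.
apply: lt_le_trans qL _; apply: le_trans (psum_le _ (leqnSn _)) _.
rewrite (@eq_psum (contract_seq theta c f) h) // => n /andP[_]; exact: ch.
Qed.

(** * Reduced digits: existence and uniqueness *)

Definition reduced L d := forall k, (2 <= k <= L)%N -> (d k < theta (k - 1))%N.

Lemma contract_seq_gt L c f k : all (fun n => n < L)%N c -> (L < k)%N ->
  contract_seq theta c f k = f k.
Proof.
move=> cL Lk; elim: c f cL => //= n c IHc f /andP[nL cL].
by rewrite IHc // contract_gt //; lia.
Qed.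

Lemma contract_seq_psum_eq L c f :
  applicable_seq theta c f -> all (fun n => n < L)%N c ->
  psum (contract_seq theta c f) L = psum f L.
Proof.
elim: c f => //= n c IHc f [an ac] /andP[nL cL].
by rewrite IHc // contract_psum_gt.
Qed.

Lemma clear_position n f : (0 < n)%N -> exists c,
  [/\ applicable_seq theta c f, all (fun m => m < n.+1)%N c &
      (contract_seq theta c f n.+1 < theta n)%N].
Proof.
move=> n0; have [m] := ubnP (f n.+1); elim: m f => // m IHm f fm.
have [lt|ge] := ltnP (f n.+1) (theta n); first by exists [::].
have [|c [ac c1 c2]] := IHm (contract theta n f).
  rewrite /contract eqxx ifN; last by apply/eqP; lia.
  have := theta_ge2 n0; lia.
by exists (n :: c); split=> //=; rewrite ltnSn.
Qed.

(** Positions are cleared from right to left: a contraction at [n] raises only the digit at [n], so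
    positions already cleared stay cleared. *)
Lemma reduce_exists L f : exists c,
  [/\ applicable_seq theta c f, all (fun n => n < L)%N c &
      reduced L (contract_seq theta c f)].
Proof.
elim: L f => [|[|L] IHL] f.
- by exists [::]; split=> // k; lia.
- by exists [::]; split=> // k; lia.
have [c [ac c1 c2]] := @clear_position L.+1 f isT.
have [d [ad d1 d2]] := IHL (contract_seq theta c f).
exists (c ++ d); split; first exact: applicable_seq_cat.
  by rewrite all_cat c1 (sub_all _ d1) // => n; exact: ltnW.
rewrite contract_seq_cat => k /andP[k2 kL].
have [kL'|kL'] := leqP k L.+1; first by apply: d2; lia.
have -> : k = L.+2 by lia.
by rewrite (contract_seq_gt _ d1) // subn1.
Qed.

(** A maximal digit at [k.+1] contributes [weight k - weight k.+1], and these bounds telescope from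
    [M] to [L]. *)
Lemma reduced_psum_lt L d M : reduced L d -> (0 < M <= L)%N ->
  psum d L <= psum d M + weight M - weight L.
Proof.
move=> rd /andP[M0]; elim: L rd => [|L IHL] rd ML; first lia.
move: ML; rewrite leq_eqVlt => /orP[/eqP ->|]; first by rewrite addrK.
rewrite ltnS => ML; rewrite psumS.
have L0 : (0 < L)%N by apply: leq_trans ML.
have {}IHL := IHL _ ML; have := rd L.+1; rewrite subn1 /= => rdL.
have dL : (d L.+1)%:R * weight L.+1 <= ((theta L)%:R - 1) * weight L.+1.
  apply: ler_wpM2r; first exact: ltW (weight_gt0 _).
  by rewrite lerBrDr natr1 ler_nat rdL //; lia.
rewrite mulrBl weightS // mul1r in dL.
have {IHL} : psum d L <= psum d M + weight M - weight L.
  by apply: IHL => k /andP[k2 kL]; apply: rd; lia.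
lra.
Qed.

Lemma psum_int f L : exists z : nat, psum f L = z%:R * weight L.
Proof.
elim: L => [|L [z IHz]]; first by exists 0%N; rewrite psum0 mul0r.
case: L IHz => [|L] IHz.
  by exists (f 1%N); rewrite psumS psum0 add0r.
exists (z * theta L.+1 + f L.+2)%N.
by rewrite psumS IHz -(@weightS L.+1) // natrD natrM; ring.
Qed.

(* Partial sums of length L lie on the grid of mesh [weight L]. *)
Lemma psum_grid f g L : psum f L < psum g L + weight L -> psum f L <= psum g L.
Proof.
have [y ->] := psum_int f L; have [z ->] := psum_int g L.
have w0 := weight_gt0 L.
by rewrite -[X in _ + X]mul1r -mulrDl ltr_pM2r // ler_pM2r // natr1 ltr_nat ler_nat.
Qed.

Lemma reduced_inj L d e : reduced L d -> reduced L e -> psum d L = psum e L ->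
  forall n, (0 < n <= L)%N -> d n = e n.
Proof.
elim: L => [|L IHL] rd re; first by move=> _ n; lia.
have mono k h : reduced L.+1 h -> (k <= L)%N -> reduced k h.
  by move=> rh kL m /andP[m2 mk]; apply: rh; lia.
(* The digit at 1 is unbounded, so the tail estimate needs a positive length; length 1 is settled
   directly. *)
have [->|L0] := posnP L.
  rewrite !psumS !psum0 weight1 !mulr1 !add0r => /eqP; rewrite eqr_nat => /eqP de n n1.
  by have -> : n = 1%N by lia.
move=> de.
(* The last digit of [h] contributes less than one mesh [weight L], so the grid turns the estimate
   into an inequality without error. *)
have step h k : reduced L.+1 h -> psum h L.+1 = psum k L.+1 -> psum k L <= psum h L.
  move=> rh hk; apply: psum_grid.
  have L1 : (0 < L <= L.+1)%N by lia.
  have := reduced_psum_lt rh L1; rewrite hk.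
  have := psum_le k (leqnSn L); have := weight_gt0 L.+1; lra.
have deL : psum d L = psum e L.
  by apply/eqP; rewrite eq_le !step.
move: (de); rewrite !psumS deL => /addrI /mulIf => /(_ (lt0r_neq0 (weight_gt0 _))).
move/eqP; rewrite eqr_nat => /eqP deS n /andP[n0].
rewrite leq_eqVlt => /orP[/eqP -> //|nL].
by apply: IHL => //; [exact: mono|exact: mono|lia].
Qed.

(** * Reaching a primary function *)

Definition reduced_all h := forall k, (2 <= k)%N -> (h k < theta (k - 1))%N.

Lemma reduced_allW L h : reduced_all h -> reduced L h.
Proof. by move=> rh k /andP[k2 _]; apply: rh. Qed.

Lemma reduced_all_psum h L M : reduced_all h -> (0 < M <= L)%N ->
  psum h L <= psum h M + weight M - weight L.
Proof. by move=> rh; apply/reduced_psum_lt/reduced_allW. Qed.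

(* After f is contracted to reduced digits up to L, its first N digits have a
   partial sum in the interval (psum f L - weight N, psum f L]; by integrality
   this determines the partial sum, and hence the digits. *)
Lemma reaches_criterion f h : reduced_all h -> f 0%N = h 0%N ->
  (forall N, (0 < N)%N -> exists2 L, (N <= L)%N &
     psum h N <= psum f L < psum h N + weight N) ->
  reaches f h.
Proof.
move=> rh fh0 fh N N0; have [L NL /andP[lo hi]] := fh N N0.
have [c [ac cL rc]] := reduce_exists L f; exists c => // n nN.
have eqL := contract_seq_psum_eq ac cL.
have [->|n0] := posnP n; first by rewrite contract_seq0.
apply: (@reduced_inj N); rewrite ?n0 //.
- by move=> k /andP[k2 kN]; apply: rc; rewrite k2 (leq_trans kN).
- exact: reduced_allW.
have dN : psum (contract_seq theta c f) L <=
    psum (contract_seq theta c f) N + weight N - weight L.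
  by apply: reduced_psum_lt; rewrite ?N0.
have := psum_le (contract_seq theta c f) NL; have := weight_gt0 L.
move: dN; rewrite eqL => dN wL dL.
by apply/eqP; rewrite eq_le !psum_grid //; lra.
Qed.

(* A digit below the maximal one leaves room strictly under the next grid point. *)
Lemma primary_gap h N : primary theta h -> (0 < N)%N ->
  exists2 e, 0 < e & forall L, psum h L <= psum h N + weight N - e.
Proof.
move=> [rh hN] N0; have [M NM hM] := hN N N0.
case: M NM hM => [|M] NM hM; first lia.
have M0 : (0 < M)%N by lia.
have {}hM : (h M.+1).+2%:R * weight M.+1 <= weight M.
  rewrite -(weightS M0) ler_wpM2r ?ler_nat ?ltW ?weight_gt0 //.
  have := rh M.+1; rewrite !subn1 /= in hM *; have := theta_ge2 M0; lia.
exists (weight M.+1) => [|L]; first exact: weight_gt0.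
apply: le_trans (psum_le _ (leq_maxl L M.+1)) _.
have /(@reduced_all_psum h) : (0 < M.+1 <= maxn L M.+1)%N by rewrite leq_maxr.
have /(@reduced_all_psum h) : (0 < N <= M)%N by lia.
move=> /(_ rh) h1 /(_ rh); rewrite psumS => h2.
have := weight_gt0 (maxn L M.+1); move: hM; rewrite -2!natr1; lra.
Qed.

(** The gap keeps the upper bound strict when it passes from [h] to [f]. The lower bound is a
    hypothesis, since [f] may approach the value of a finite [h] without attaining it. *)
Lemma reaches_primary f h : primary theta h -> same_value f h ->
  f 0%N = h 0%N -> (forall N, exists L, psum h N <= psum f L) -> reaches f h.
Proof.
move=> ph fh fh0 le_hf; apply: reaches_criterion => // [|N N0]; first by case: ph.
have [L NL] := le_hf N; exists (maxn N L); first exact: leq_maxl.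
rewrite (le_trans NL) ?psum_le ?leq_maxr //=.
have [e e0 /(same_value_bound fh) he] := primary_gap ph N0.
by have := he (maxn N L); lra.
Qed.

(** * Pairs of a primary and a secondary expansion *)

Lemma W1_psum p : W1 theta p -> exists2 N, (0 < N)%N &
  [/\ p.1 0%N = p.2 0%N, forall L, (L < N)%N -> psum p.2 L = psum p.1 L,
      forall L, (N <= L)%N -> psum p.2 L = psum p.1 L - weight L &
      p.2 N.+1 != 0%N].
Proof.
move=> [_ _ [N [[[N0 maxN] _] ltN eqN gtN]]]; exists N => //; split.
- exact: ltN.
- move=> L LN; apply: eq_psum => n /andP[_ nL].
  by rewrite ltN //; apply: leq_ltn_trans LN.
- elim=> [|L IHL]; first lia.
  rewrite leq_eqVlt => /orP[/eqP NL|].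
    rewrite !psumS -NL eqN natrD (@eq_psum p.2 p.1); first by ring.
    by move=> n /andP[_ nL]; rewrite ltN // NL.
  (* Beyond [N] the digit of [p.1] is 0 and that of [p.2] is maximal, which shrinks the lag from
     [weight L] to [weight L.+1]. *)
  rewrite ltnS => NL; rewrite !psumS IHL // gtN // maxN ?subn1 /=; last lia.
  have L0 : (0 < L)%N by lia.
  by rewrite -subn1 natrB ?(ltnW (theta_ge2 L0)) // -(weightS L0); ring.
- rewrite maxN ?addn1 // !subn1 /=; have := theta_ge2 N0; lia.
Qed.

(** The secondary expansion never attains its value: from some length on it lags behind the primary
    one by a positive weight. *)
Lemma W1_psum_lt p M : W1 theta p -> exists2 L, (M <= L)%N & psum p.2 M < psum p.1 L.
Proof.
move=> /W1_psum[N _ [_ _ hi _]]; exists (maxn M N); first exact: leq_maxl.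
apply: le_lt_trans (psum_le _ (leq_maxl M N)) _.
by rewrite hi ?leq_maxr // ltrBlDr ltrDl weight_gt0.
Qed.

Lemma W1_same_value p : W1 theta p -> same_value p.1 p.2.
Proof.
move=> Wp q; split=> -[L qL]; last first.
  by have [M _ LM] := W1_psum_lt L Wp; exists M; apply: lt_trans LM.
have [N _ [_ _ hi _]] := W1_psum Wp.
(* From length [K] on, the lag of [p.2] is smaller than the margin of [psum p.1 L] over [q]. *)
have [|K LK] := @weight_small (psum p.1 L - q); first by rewrite subr_gt0.
have := LK _ (leq_maxr (maxn L N) K); set M := maxn _ K => wM.
exists M; rewrite hi; last by rewrite /M; lia.
have : psum p.1 L <= psum p.1 M by apply: psum_le; rewrite /M; lia.
lra.
Qed.

Lemma W1_not_null p : W1 theta p -> ~ null p.1 /\ ~ null p.2.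
Proof.
move=> Wp; have [N N0 [_ _ _ p2]] := W1_psum Wp.
suff np2 : ~ null p.2.
  by split=> // /(same_value_null (W1_same_value Wp)).
by move=> n2; rewrite n2 in p2.
Qed.

Lemma reaches_secondary f p N : W1 theta p -> same_value f p.1 ->
  f 0%N = p.2 0%N -> (forall L, psum f L < psum p.1 N) -> reaches f p.2.
Proof.
move=> Wp fp f0 ltf; have rp : reduced_all p.2 by case: Wp => _ [].
have [N0 N00 [_ _ hi _]] := W1_psum Wp.
apply: reaches_criterion => // M M0.
have [L _ /(ex_intro _ L)/fp[K MK]] := W1_psum_lt M Wp.
exists (maxn M K); first exact: leq_maxl.
rewrite (le_trans (ltW MK)) ?psum_le ?leq_maxr //=.
(* At [J] the lag of [p.2] is exactly [weight J], which cancels against the tail estimate for [p.2]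
   between [M] and [J]. *)
apply: lt_le_trans (ltf _) _; pose J := maxn N (maxn N0 M).
have NJ : psum p.1 N <= psum p.1 J by apply: psum_le; rewrite leq_maxl.
have pJ : psum p.2 J = psum p.1 J - weight J by apply: hi; rewrite /J; lia.
have : psum p.2 J <= psum p.2 M + weight M - weight J.
  by apply: reduced_all_psum; rewrite // M0 /J; lia.
lra.
Qed.

Lemma finite_primary h N : reduced_all h -> (forall k, (N < k)%N -> h k = 0%N) ->
  primary theta h.
Proof.
move=> rh hN; split=> // M M0; exists (maxn N M).+1; first lia.
rewrite hN ?ltnS ?leq_maxl // !subn1 /=.
have M1 : (0 < maxn N M)%N by lia.
by have := theta_ge2 M1; lia.
Qed.

Lemma finite_W1 h N : reduced_all h -> (forall k, (N < k)%N -> h k = 0%N) ->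
  ~ null h -> exists2 p, W1 theta p & p.1 = h.
Proof.
move=> rh hN nh.
have exQ : exists n, (0 < n)%N && (h n != 0%N).
  apply: contrapT => nQ; apply: nh => n n0; apply/eqP/negPn/negP => hn.
  by apply: nQ; exists n; rewrite n0.
have leQ n : (0 < n)%N && (h n != 0%N) -> (n <= N)%N.
  by move=> /andP[_ hn]; rewrite leqNgt; apply: contra hn => /hN ->.
have [m /andP[m0 hm] mmax] := ex_maxnP exQ leQ.
have hgt k : (m < k)%N -> h k = 0%N.
  move=> mk; apply/eqP/negPn/negP => hk.
  by have := mmax k; rewrite hk andbT; lia.
(* With [m] the last nonzero position, [s] is the analogue of 0.999... for 1. *)
pose s k := (if k < m then h k else if k == m then h m - 1 else theta (k - 1) - 1)%N.
have sm : s m = (h m - 1)%N by rewrite /s ltnn eqxx.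
have sgt k : (m < k)%N -> s k = (theta (k - 1) - 1)%N.
  by move=> mk; rewrite /s !ifN //; [apply/eqP|]; lia.
have slt k : (k < m)%N -> s k = h k by rewrite /s => ->.
have maxm : maximal_after theta s m by split=> // M mM; apply: sgt; lia.
exists (h, s) => //; split=> /=; first exact: finite_primary hN.
  split; last by exists m.
  move=> k; case: (ltngtP k m) => [/slt ->|/sgt ->|->] k2.
  - exact: rh.
  - have k1 : (0 < k - 1)%N by lia.
    by have := theta_ge2 k1; lia.
  - by rewrite sm; have := rh m k2; lia.
exists m; split=> //.
(* A smaller [n] would make [s m] maximal, forcing [h m = theta (m - 1)] against reducedness. *)
- split=> // n [n0 nmax]; rewrite leqNgt; apply/negP => nm.
  have := nmax m; rewrite sm; have := rh m; lia.
- by move=> k /slt.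
- by rewrite sm; lia.
Qed.

(* If the partial sums of f stay below some psum h N, then h is finite and f,
   never attaining the value of h, reaches its secondary expansion instead. *)
Lemma reaches_base h f : primary theta h -> same_value f h -> f 0%N = h 0%N ->
  reaches f h \/ exists p, [/\ W1 theta p, p.1 = h & reaches f p.2].
Proof.
move=> ph fh f0; have [le_hf|] := pselect (forall N, exists L, psum h N <= psum f L).
  by left; exact: reaches_primary.
move=> /existsNP[N /forallNP nle].
have ltf L : psum f L < psum h N by rewrite ltNge; apply/negP/nle.
have /same_value_bound - /(_ _ (same_value_sym fh)) leh : forall L, psum f L <= psum h N.
  by move=> L; exact: ltW.
have hN k : (N < k)%N -> h k = 0%N.
  case: k => // k; rewrite ltnS => Nk; apply/eqP; rewrite -leqn0 leqNgt.
  apply/negP => hk; have := leh k.+1; rewrite psumS; have := psum_le h Nk.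
  have : 0 < (h k.+1)%:R * weight k.+1 by rewrite mulr_gt0 ?weight_gt0 ?ltr0n.
  lra.
have nh : ~ null h.
  move=> h0; have := ltf 0%N; rewrite psum0 (@eq_psum h (fun=> 0%N)).
    by rewrite /psum big1 ?ltxx // => n _; rewrite mul0r.
  by move=> n /andP[/h0].
have [p Wp ph1] := finite_W1 (proj1 ph) hN nh.
right; exists p; split=> //; apply: (@reaches_secondary f p N) => //; rewrite ?ph1 //.
by have [_ _ [<- _ _ _]] := W1_psum Wp; rewrite ph1.
Qed.

(** * Changing the value at 0, and membership in $r_b$ *)

Definition upd (c : nat) (h : nat -> nat) n := if n == 0%N then c else h n.

Lemma upd_id h : upd (h 0%N) h = h.
Proof. by apply/funext => n; rewrite /upd; case: eqP => [->|]. Qed.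

Lemma upd_upd c d h : upd c (upd d h) = upd c h.
Proof. by apply/funext => n; rewrite /upd; case: eqP. Qed.

Lemma upd_gt0 c h n : (0 < n)%N -> upd c h n = h n.
Proof. by rewrite /upd; case: eqP => [->|]. Qed.

Lemma primary_upd c h : primary theta h -> primary theta (upd c h).
Proof.
move=> [rh hN]; split=> [k k2|N /hN[M NM hM]]; first by rewrite upd_gt0 ?rh //; lia.
by exists M => //; rewrite upd_gt0 //; lia.
Qed.

Lemma maximal_after_upd c h N : maximal_after theta (upd c h) N <-> maximal_after theta h N.
Proof.
split=> -[N0 hN]; split=> // M NM; have := hN M NM; rewrite upd_gt0 //; lia.
Qed.

Lemma W1_upd c p : W1 theta p -> W1 theta (upd c p.1, upd c p.2).
Proof.
move=> [p1 [r2 m2] [N [[mN Nmin] ltN eqN gtN]]]; split=> /=.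
- exact: primary_upd.
- split=> [k k2|]; first by rewrite upd_gt0 ?r2 //; lia.
  by have [M mM] := m2; exists M; rewrite maximal_after_upd.
have N0 := proj1 mN; exists N; split=> /=.
- by split=> [|M]; rewrite maximal_after_upd //; exact: Nmin.
- by move=> k kN; rewrite /upd ltN.
- by rewrite !upd_gt0.
- by move=> k Nk; rewrite upd_gt0 ?gtN //; lia.
Qed.

(** Restoring the old value at 0 would turn a pair containing [upd c h] into one containing [h]. *)
Lemma W2_upd c h : W2 theta h -> W2 theta (upd c h).
Proof.
move=> [ph nW]; split; first exact: primary_upd.
by move=> q /(@W1_upd (h 0%N)) /nW /=; rewrite -{1 3}(upd_id h);
  case=> n1 n2; split=> e; [apply: n1|apply: n2]; rewrite -e upd_upd.
Qed.

Lemma sign_eq0 f g : f 0%N = g 0%N -> sign f = sign g.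
Proof. by rewrite /sign => ->. Qed.

(** This provides what [reaches_base] asks for: a primary representative whose secondary partners,
    if any, also lie in [b]. *)
Lemma base_primary b h : base theta b -> b h -> exists h',
  [/\ primary theta h', b h', same_value h h', h 0%N = h' 0%N &
      forall p, W1 theta p -> p.1 = h' -> b p.2].
Proof.
move=> [[p Wp ->]|[k Wk ->]] /= bh.
  have [q [Wq pq hq]] := bh; have [N _ [q0 _ _ _]] := W1_psum Wq.
  exists q.1; split.
  - by case: Wq.
  - by exists q; split=> //; left.
  - case: hq => -> //; exact/same_value_sym/W1_same_value.
  - by case: hq => ->.
  - by move=> q' Wq' eq'; exists q'; split=> //; [rewrite eq'|right].
exists h; split=> //; first by case: bh => -[].
by move=> q Wq qh; have [[_ /(_ q Wq)[]]] := bh; rewrite qh.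
Qed.

(** Contractions never touch position 0, while [b] fixes only the parity there; so a member of [b]
    can be adapted to the function that is to reach it. *)
Lemma base_upd b h c : base theta b -> b h -> sign (fun=> c) = sign h -> b (upd c h).
Proof.
move=> [[p Wp ->]|[k Wk ->]] /= bh ch.
  have [q [Wq pq hq]] := bh; exists (upd c q.1, upd c q.2).
  split=> /=; first exact: W1_upd.
    have [pq0 spq] := pq; split=> [n n0|]; first by rewrite upd_gt0 ?pq0.
    rewrite spq; have [N _ [q0 _ _ _]] := W1_psum Wq.
    have -> : sign (upd c q.1) = sign h by rewrite -ch.
    by apply: sign_eq0; case: hq => ->.
  by case: hq => ->; [left|right].
have [Wh [kh skh]] := bh; split; first exact: W2_upd.
by split=> [n n0|]; [rewrite upd_gt0 ?kh|rewrite skh -ch].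
Qed.

Lemma base_same_value b h h' : base theta b -> b h -> b h' ->
  same_value h h' /\ sign h = sign h'.
Proof.
move=> [[p Wp ->]|[k Wk ->]] /= bh bh'.
  suff key g : (exists q, [/\ W1 theta q, equiv_fun p.1 q.1 & g = q.1 \/ g = q.2]) ->
      same_value p.1 g /\ sign p.1 = sign g.
    have [h1 h2] := key _ bh; have [h1' h2'] := key _ bh'.
    by split; [exact: same_value_trans (same_value_sym h1) _|rewrite -h2].
  move=> [q [Wq [pq spq] gq]]; have {}pq := eq_same_value pq.
  case: gq => -> //; split.
    exact: same_value_trans pq (W1_same_value Wq).
  by rewrite spq; apply: sign_eq0; have [N _ []] := W1_psum Wq.
have [[_ [h1 h2]] [_ [h1' h2']]] := (bh, bh').
by split; [apply: eq_same_value => n n0; rewrite -h1 ?h1'|rewrite -h2].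
Qed.

(** For the converse, [h] is given the value of [f] at 0 and replaced by a primary representative;
    then [f] reaches that one or its secondary partner. *)
Lemma real_of_baseP b h f : base theta b -> b h ->
  real_of_base theta b f <-> same_value f h /\ sign f = sign h.
Proof.
move=> Bb bh; split=> [[k bk /reaches_same_value[fk fk0]]|[fh sfh]].
  have [kh skh] := base_same_value Bb bk bh.
  by split; [exact: same_value_trans kh|rewrite -skh; exact: sign_eq0].
have bu := base_upd Bb bh sfh.
have [k [pk bk uk uk0 kW]] := base_primary Bb bu.
have fk : same_value f k.
  apply: same_value_trans uk; apply: same_value_trans fh _.
  by apply: eq_same_value => n n0; rewrite upd_gt0.
have [|[p [Wp pk1 fp]]] := reaches_base pk fk uk0; first by exists k.
by exists p.2 => //; exact: kW.
Qed.

(** * Zero, and the real numbers as classes of equal value and sign *)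

Lemma null_primary h : null h -> primary theta h.
Proof.
move=> h0; apply: (@finite_primary h 0%N) => [k k2|//].
have k1 : (0 < k - 1)%N by lia.
rewrite h0; last lia.
by have := theta_ge2 k1; lia.
Qed.

Lemma null_W2 h : null h -> W2 theta h.
Proof.
move=> h0; split; first exact: null_primary.
by move=> q /W1_not_null[n1 n2]; split=> e; [apply: n1|apply: n2]; rewrite -e.
Qed.

(** Components of pairs in [W1] are never null, so [b] is a class of [W2]. *)
Lemma null_baseE b h : base theta b -> b h -> null h ->
  b = [set f | null f /\ sign f = sign h].
Proof.
move=> Bb bh h0; apply/seteqP; split=> f /=.
  move=> bf; have [hf shf] := base_same_value Bb bh bf.
  by split=> //; exact: same_value_null h0.
case: Bb bh => [[p Wp ->] [q [/W1_not_null[n1 n2] _ hq]]|[k Wk ->] [Wh [kh skh]]] [f0 sf].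
  by case: hq => e; [case: n1|case: n2]; rewrite -e.
by split; [exact: null_W2|split=> [n n0|]; rewrite ?sf // kh // h0 ?f0].
Qed.

Lemma null_base h : null h -> base theta [set f | null f /\ sign f = sign h].
Proof.
move=> h0; right; exists h; first exact: null_W2.
apply/seteqP; split=> f /= [f0 sf]; split.
- exact: null_W2.
- by split=> // n n0; rewrite h0 ?f0.
- by move=> n n0; case: sf => <- // _; rewrite h0.
- by case: sf.
Qed.

Lemma null_block h : null h ->
  block (base theta) h = [set f | null f /\ sign f = sign h].
Proof.
move=> h0; apply/seteqP; split=> f /=.
  by move=> [X [BX Xh]]; rewrite (null_baseE BX Xh h0).
by move=> hf; exists [set f | null f /\ sign f = sign h]; split=> //; exact: null_base.
Qed.

Lemma real_zeroE : real_zero theta = null.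
Proof.
have E h f : null h -> real_of_base theta (block (base theta) h) f <->
    null f /\ sign f = sign h.
  move=> h0; rewrite null_block // (real_of_baseP _ (null_base h0) (conj h0 erefl)).
  split=> -[f1 f2]; split=> //; first exact: same_value_null (same_value_sym f1) h0.
  by apply: eq_same_value => n n0; rewrite f1 ?h0.
apply/seteqP; split=> f /=.
  by case=> /E[] // -[].
move=> f0; have [fo|fe] := boolP (odd (f 0%N)); [right|left]; apply/E => //.
- by case.
- by split=> //; rewrite /sign fo.
- by split=> //; rewrite /sign (negbTE fe).
Qed.

(** The disjunct [null g] reflects that the two signed zeros form one real number. *)
Definition equal_real f g := same_value f g /\ (null g \/ sign f = sign g).

Lemma realsE X g : reals theta X -> X g -> X = [set f | equal_real f g].
Proof.
case=> [[b [Bb bev bod ->]] [h bh]|->]; last first.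
  rewrite real_zeroE => g0; apply/seteqP; split=> f /=.
    by move=> f0; split; [apply: eq_same_value => n n0; rewrite f0 ?g0|left].
  by move=> [/same_value_sym fg _]; exact: same_value_null g0.
move=> gh; have /(real_of_baseP g Bb bh)[{}gh sgh] : real_of_base theta b g by exists h.
(* A null member would make [b] one of the two excluded base elements, according to the parity at
   0. *)
have ng : ~ null g.
  move=> /(same_value_null gh) h0.
  have := null_baseE Bb bh h0.
  have [oh|eh] := boolP (odd (h 0%N)) => e.
    apply: bod; rewrite /base_zero_odd null_block; last by case.
    by rewrite e; have -> : sign h = 0%N by rewrite /sign oh.
  apply: bev; rewrite /base_zero_even null_block // e.
  by have -> : sign h = 1%N by rewrite /sign (negbTE eh).
apply/seteqP; split=> f /=; rewrite (real_of_baseP f Bb bh).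
  move=> [fh sfh]; split; last by right; rewrite sfh.
  exact: same_value_trans fh (same_value_sym gh).
by move=> [fg [//|sfg]]; split; [exact: same_value_trans gh|rewrite sfg].
Qed.

Lemma reals_inhabited X : reals theta X -> exists g, X g.
Proof.
case=> [[b [Bb _ _ ->]]|->]; last by exists (fun=> 0%N); rewrite real_zeroE.
suff [h bh] : exists h, b h by exists h; apply/(real_of_baseP h Bb bh).
case: Bb => [[p Wp ->]|[h Wh ->]]; last by exists h.
by exists p.1; exists p; split=> //; left.
Qed.

Lemma real_classE X g : reals theta X -> X g -> real_class theta g = X.
Proof.
move=> RX Xg; apply/seteqP; split=> f; last by exists X.
by move=> [Y [RY Yg]]; rewrite (realsE RY Yg) (realsE RX Xg).
Qed.

(** * The rest function as digits of products of weights *)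

Lemma RmaxE n k K : Rmax theta n k K = (P K %/ (P n * P k))%N.
Proof.
have d0 : (0 < P n * P k)%N by rewrite muln_gt0 !prod_below_gt0.
apply/eqP; rewrite eqn_leq; apply/andP; split.
  by apply/bigmax_leqP => t; rewrite leq_divRL // mulnA.
have lt : (P K %/ (P n * P k) < (P K).+1)%N by rewrite ltnS leq_div.
by apply: (@leq_bigmax_cond _ _ _ (Ordinal lt)); rewrite /= -mulnA leq_trunc_div.
Qed.

(** [Rmax theta n k L] counts the meshes [weight L] that fit into [weight n * weight k]; rounding
    down to this grid loses at most one mesh. *)
Lemma Rmax_weight_le n k L : (Rmax theta n k L)%:R * weight L <= weight n * weight k.
Proof.
rewrite /weight -invfM ler_pdivrMr ?ltr0n ?prod_below_gt0 // mulrC.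
rewrite ler_pdivlMr ?mulr_gt0 ?ltr0n ?prod_below_gt0 //.
by rewrite -!natrM ler_nat RmaxE leq_trunc_div.
Qed.

Lemma Rmax_weight_ge n k L :
  weight n * weight k - weight L <= (Rmax theta n k L)%:R * weight L.
Proof.
rewrite lerBlDr -[X in _ + X]mul1r -mulrDl natr1 /weight -invfM.
rewrite ler_pdivlMr ?ltr0n ?prod_below_gt0 // mulrC.
rewrite ler_pdivrMr ?mulr_gt0 ?ltr0n ?prod_below_gt0 //.
by rewrite -!natrM ler_nat RmaxE ltnW // ltn_ceil // muln_gt0 !prod_below_gt0.
Qed.

(** This orders the two arguments of [upsilon] in the rest function, whose absolute difference thus
    becomes a subtraction. *)
Lemma Rmax_monotone n k M : (0 < M)%N ->
  (theta M * Rmax theta n k M <= Rmax theta n k M.+1)%N.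
Proof.
move=> M0; have d0 : (0 < P n * P k)%N by rewrite muln_gt0 !prod_below_gt0.
rewrite !RmaxE prod_belowS // leq_divRL // -mulnA mulnC leq_mul2r.
by rewrite leq_trunc_div orbT.
Qed.

Lemma rest_telescope n k L : (0 < L)%N ->
  \sum_(1 <= M < L.+1) (rest theta n k M)%:R * weight M =
  (Rmax theta n k L)%:R * weight L.
Proof.
case: L => // L _; elim: L => [|L IHL]; first by rewrite big_nat1 /rest eqxx.
rewrite big_nat_recr //= IHL /rest /= subn1 /= /upsilon.
have le := Rmax_monotone n k (ltn0Sn L).
by rewrite (maxn_idPl le) (minn_idPr le) natrB // natrM -(@weightS L.+1) //; ring.
Qed.

Lemma prod_below_lt n m : (0 < n)%N -> (n < m)%N -> (P n < P m)%N.
Proof.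
move=> n0 nm; apply: (@leq_trans (P n.+1)); last first.
  by rewrite dvdn_leq ?prod_below_gt0 // dvdn_prod_below.
by rewrite prod_belowS // ltn_Pmulr ?prod_below_gt0 // theta_ge2.
Qed.

(** A product of weights smaller than the mesh is rounded down to 0. Hence the sums in the
    sub-product may run up to any common bound. *)
Lemma rest_eq0 n k M : (0 < M)%N -> (M < maxn n k)%N -> rest theta n k M = 0%N.
Proof.
move=> M0 Mnk; have R0 m : (0 < m)%N -> (m < maxn n k)%N -> Rmax theta n k m = 0%N.
  move=> m0; rewrite RmaxE leq_max => /orP[] /(prod_below_lt m0) mlt; apply: divn_small.
    by rewrite (leq_trans mlt) // leq_pmulr ?prod_below_gt0.
  by rewrite (leq_trans mlt) // leq_pmull ?prod_below_gt0.
rewrite /rest; case: eqP => [M1|M1]; first by rewrite R0 // -M1.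
by rewrite !R0 ?muln0 //; lia.
Qed.

(** * Partial sums of the sub-product *)

Lemma subproduct_widen f g M L : (0 < M <= L)%N ->
  subproduct theta f g M =
  (\sum_(1 <= n < L.+1) \sum_(1 <= k < L.+1) f n * g k * rest theta n k M)%N.
Proof.
move=> /andP[M0 ML]; rewrite /subproduct ifN; last by rewrite -lt0n.
rewrite [RHS](@big_cat_nat _ _ _ M.+1) //= [X in (_ + X)%N]big1_seq ?addn0.
  apply: eq_bigr => n _; rewrite [RHS](@big_cat_nat _ _ _ M.+1) //=.
  rewrite [X in (_ + X)%N]big1_seq ?addn0 // => k; rewrite mem_index_iota => /andP[_ /andP[Mk _]].
  by rewrite rest_eq0 ?muln0 // leq_max Mk orbT.
move=> n; rewrite mem_index_iota => /andP[_ /andP[Mn _]].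
by rewrite big1 // => k _; rewrite rest_eq0 ?muln0 // leq_max Mn.
Qed.

(** Once the inner ranges no longer depend on [M], the sums can be exchanged and the sum over [M]
    telescopes. *)
Lemma psum_subproduct f g L :
  psum (subproduct theta f g) L =
  \sum_(1 <= n < L.+1) \sum_(1 <= k < L.+1)
    (f n)%:R * (g k)%:R * ((Rmax theta n k L)%:R * weight L).
Proof.
have [->|L0] := posnP L; first by rewrite psum0 big_geq.
under eq_bigr => n _ do under eq_bigr => k _ do rewrite -rest_telescope // mulr_sumr.
under eq_bigr => n _ do rewrite exchange_big /=.
rewrite exchange_big /=; apply: eq_big_nat => M /andP[M0 ML].
rewrite (@subproduct_widen f g M L) ?M0 // natr_sum mulr_suml.
apply: eq_bigr => n _; rewrite natr_sum mulr_suml.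
by apply: eq_bigr => k _; rewrite !natrM mulrA.
Qed.

Lemma psum_subproduct_le f g L :
  psum (subproduct theta f g) L <= psum f L * psum g L.
Proof.
rewrite psum_subproduct big_distrlr /=; apply: ler_sum => n _; apply: ler_sum => k _.
rewrite [X in _ <= X]mulrACA ler_wpM2l ?mulr_ge0 //; exact: Rmax_weight_le.
Qed.

Lemma ler_sum_widen (F : nat -> rat) K L : (K <= L)%N -> (forall n, 0 <= F n) ->
  \sum_(1 <= n < K.+1) F n <= \sum_(1 <= n < L.+1) F n.
Proof.
move=> KL F0; rewrite [X in _ <= X](@big_cat_nat _ _ _ K.+1) //=.
by rewrite lerDl sumr_ge0.
Qed.

(** Only terms with both indices up to [K] are kept: their coefficients stay fixed as [L] grows, so
    the total rounding error tends to 0. *)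
Lemma psum_subproduct_ge f g K L : (K <= L)%N ->
  psum f K * psum g K -
    (\sum_(1 <= n < K.+1) \sum_(1 <= k < K.+1) (f n)%:R * (g k)%:R) * weight L
  <= psum (subproduct theta f g) L.
Proof.
move=> KL; have F0 n k : 0 <= (f n)%:R * (g k)%:R * ((Rmax theta n k L)%:R * weight L).
  by rewrite !mulr_ge0 // ltW // weight_gt0.
rewrite psum_subproduct; apply: le_trans (ler_sum_widen KL _); last first.
  by move=> n; apply: sumr_ge0.
rewrite big_distrlr mulr_suml -sumrB /=; apply: ler_sum => n _.
apply: le_trans (ler_sum_widen KL _); last by [].
rewrite mulr_suml -sumrB; apply: ler_sum => k _.
rewrite mulrACA -mulrBr ler_wpM2l ?mulr_ge0 //; exact: Rmax_weight_ge.
Qed.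

(** * The neutral element *)

Definition unit_digits n := if n == 1%N then 1%N else 0%N.

Lemma psum_unit L : psum unit_digits L <= 1 /\ ((0 < L)%N -> psum unit_digits L = 1).
Proof.
have E M : psum unit_digits M.+1 = 1.
  elim: M => [|M IHM]; first by rewrite psumS psum0 /unit_digits eqxx mul1r weight1.
  by rewrite psumS IHM /unit_digits /= mul0r addr0.
by case: L => [|L]; rewrite ?psum0 ?E.
Qed.

Lemma subproduct_unit f g : same_value f unit_digits ->
  same_value (subproduct theta f g) g.
Proof.
move=> f1 q; have fle L : psum f L <= 1.
  by apply: (same_value_bound f1) => M; have [] := psum_unit M.
split=> -[K qK].
  exists K; apply: lt_le_trans qK _; apply: le_trans (psum_subproduct_le _ _ _) _.
  by rewrite ler_piMl ?psum_ge0.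
set y := psum g K in qK; have y0 : 0 <= y := psum_ge0 g K.
have y1 : 0 < y + 1 by rewrite ltr_wpDl.
(* All partial sums of [f] may be below 1, so 1 is approximated by a [t] for which [t * y] loses at
   most half of the margin [y - q]; the divisor [y + 1] also covers [y = 0]. *)
pose t := 1 - (y - q) / 2 / (y + 1).
have d0 : 0 < (y - q) / 2 by rewrite divr_gt0 ?subr_gt0.
have [M tM] : below f t.
  apply/f1; exists 1%N; rewrite (proj2 (psum_unit 1)) //.
  by rewrite ltrBlDr ltrDl divr_gt0.
pose J := maxn K M.
have tyJ : q + (y - q) / 2 <= psum f J * psum g J.
  apply: (@le_trans _ _ (t * y)).
    have : (y - q) / 2 / (y + 1) * y <= (y - q) / 2.
      by rewrite mulrAC ler_pdivrMr // (ler_wpM2l (ltW d0)) // lerDl.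
    rewrite /t; lra.
  apply: (@le_trans _ _ (psum f J * y)).
    by rewrite ler_wpM2r // (le_trans (ltW tM)) // psum_le // leq_maxr.
  by rewrite ler_wpM2l ?psum_ge0 // psum_le // leq_maxl.
set C := \sum_(1 <= n < J.+1) \sum_(1 <= k < J.+1) (f n)%:R * (g k)%:R : rat.
have C0 : 0 <= C by rewrite sumr_ge0 // => n _; rewrite sumr_ge0 // => k _; rewrite mulr_ge0.
have C1 : 0 < C + 1 by rewrite ltr_wpDl.
(* The other half of the margin absorbs the rounding error, [C] times a weight. *)
have [|L wL] := @weight_small ((y - q) / 2 / (C + 1)); first by rewrite divr_gt0.
have {wL} : weight (maxn J L) < (y - q) / 2 / (C + 1) by rewrite wL ?leq_maxr.
rewrite ltr_pdivlMr // mulrDr mulr1 => wL.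
have := psum_subproduct_ge f g (leq_maxl J L); rewrite -/C => fgJ.
exists (maxn J L); have := weight_gt0 (maxn J L); lra.
Qed.

Lemma unit_base : exists2 b, base theta b & b unit_digits.
Proof.
have ne : ~ null unit_digits by move/(_ 1%N isT).
have [k k2||p Wp p1] := @finite_W1 unit_digits 1 _ _ ne.
- rewrite /unit_digits ifN; last by apply/eqP; lia.
  have k1 : (0 < k - 1)%N by lia.
  by have := theta_ge2 k1; lia.
- by move=> k k1; rewrite /unit_digits ifN //; apply/eqP; lia.
exists [set h | exists q, [/\ W1 theta q, equiv_fun p.1 q.1 & h = q.1 \/ h = q.2]].
  by left; exists p.
by exists p; split=> //; left.
Qed.

(** Sign 1 means an even value at 0, and adding it preserves parity. *)
Lemma sign_subproduct f g : sign f = 1%N -> sign (subproduct theta f g) = sign g.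
Proof. by rewrite /sign /subproduct /= oddD; case: (odd (f 0%N)). Qed.

Lemma real_unit : exists x, reals theta x /\
  forall a, reals theta a -> real_mul theta x a = a.
Proof.
have [b Bb be] := unit_base.
have ne h : b h -> ~ null h.
  move=> bh /(same_value_null (proj1 (base_same_value Bb bh be))).
  by move/(_ 1%N isT).
have Rb : reals theta (real_of_base theta b).
  left; exists b; split=> // eb; apply: (ne _ be); move: be; rewrite eb.
    by rewrite /base_zero_even null_block // => -[].
  by rewrite /base_zero_odd null_block => [[]|[]].
exists (real_of_base theta b); split=> // a Ra.
have mulE f g : real_of_base theta b f -> a g ->
    real_class theta (subproduct theta f g) = a.
  move=> /(real_of_baseP f Bb be)[f1 sf] ag; apply: real_classE => //.
  rewrite (realsE Ra ag); split; first exact: subproduct_unit.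
  by right; rewrite sign_subproduct.
apply/seteqP; split=> h /=; last by move=> ah f g bf ag; rewrite (mulE f g).
(* Representatives of both factors are exhibited, since an intersection over no pair would contain
   every function. *)
have be1 : real_of_base theta b unit_digits by apply/(real_of_baseP _ Bb be).
by have [g ag] := reals_inhabited Ra; move=> /(_ _ _ be1 ag); rewrite mulE.
Qed.

End Expansions.

Theorem mainTheorem11 (theta : nat -> nat)
    (theta_system : system_function theta) :
  exists x : set (nat -> nat),
    reals theta x /\
    forall a : set (nat -> nat), reals theta a -> real_mul theta x a = a.
Proof. exact: real_unit. Qed.
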